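(* Let $f:[0,\infty)\to\mathbb{R}$ be a Lipschitz function which, for some $p_M>0$, satisfies one of the following: (bistable) there is $\alpha\in(0,p_M)$ with $f>0$ in $(\alpha,p_M)$ and $f<0$ in $[0,\alpha)\cup(p_M,\infty)$; or (monostable) $f(0)=0$, $f>0$ in $(0,p_M)$ and $f<0$ in $(p_M,\infty)$. Let $K:=\sup_{p>0}\frac{f(p)}{p}<\infty$. For $L>0$ consider the problem $$-u''=f(u),\quad u\ge0\ \text{ in }(0,L),\qquad u(0)=u(L)=0.\tag{$*$}$$ 1. If $\int_0^{p_M}f(s)\,ds<0$, then $( * )$ has no solution (for any $L>0$). 2. If $\int_0^{p_M}f(s)\,ds>0$, then there exists $L_0\ge\frac{\pi}{\sqrt K}$ such that: (i) if $L<L_0$, then $( * )$ has no non-trivial solution; (ii) if $L>L_0$, then $( * )$ has at least one non-trivial solution with support $(0,L)$, i.e. with $\{u>0\}=(0,L)$.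
   Context: A non-trivial solution is a solution that is not identically zero. *)

(* Defs.v *)
(* Real analysis over the Stdlib reals with Coquelicot. *)
From Stdlib Require Import Reals.
From Coquelicot Require Import Coquelicot.
Open Scope R_scope.

(* A function [0, oo) -> R is given by a total [f : R -> R], and a function
   [0, L] -> R by a total [u : R -> R].  The values outside these domains are
   never constrained and never matter. *)

Definition lipschitz_on_nonneg (f : R -> R) : Prop :=
  exists C : R, forall p q : R, 0 <= p -> 0 <= q ->
    Rabs (f p - f q) <= C * Rabs (p - q).

Definition bistable (f : R -> R) (pM : R) : Prop :=
  exists alpha : R,
    0 < alpha < pM /\
    (forall p : R, alpha < p < pM -> 0 < f p) /\
    (forall p : R, 0 <= p < alpha \/ pM < p -> f p < 0).

Definition monostable (f : R -> R) (pM : R) : Prop :=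
  f 0 = 0 /\
  (forall p : R, 0 < p < pM -> 0 < f p) /\
  (forall p : R, pM < p -> f p < 0).

Definition sup_ratio (f : R -> R) : Rbar :=
  Lub_Rbar (fun k : R => exists p : R, 0 < p /\ k = f p / p).

(* Classical solutions: continuous on [0, L], twice differentiable in (0, L).
   For continuous [f], [u''] is then continuous, so [u] is C^2 in (0, L).
   [ex_derive u x] is not redundant: [Derive u] is total, so its
   differentiability at [x] does not entail that of [u]. *)
Definition is_solution (f : R -> R) (L : R) (u : R -> R) : Prop :=
  continuous_on (fun x : R => 0 <= x <= L) u /\
  (forall x : R, 0 < x < L -> ex_derive u x /\ ex_derive (Derive u) x) /\
  (forall x : R, 0 < x < L -> - Derive_n u 2 x = f (u x)) /\
  (forall x : R, 0 < x < L -> 0 <= u x) /\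
  u 0 = 0 /\ u L = 0.

Definition nontrivial (L : R) (u : R -> R) : Prop :=
  exists x : R, 0 <= x <= L /\ u x <> 0.

(* {u > 0} = (0, L), as subsets of the domain [0, L]. *)
Definition positivity_set_is_interior (L : R) (u : R -> R) : Prop :=
  forall x : R, 0 <= x <= L -> (0 < u x <-> 0 < x < L).

(* Main.v *)
Require Import Defs.
From Stdlib Require Import Reals Lra Lia ClassicalEpsilon.
From Coquelicot Require Import Coquelicot.
Open Scope R_scope.
Set Bullet Behavior "Strict Subproofs".

(** Extend [f] to negative arguments by [f 0], giving a globally Lipschitz [g]
    with potential [F p = RInt g 0 p], and let [U_M] be the even solution of
    [U'' = - g(U)], [U(0) = M], [U'(0) = 0].  By uniqueness a solution with
    maximum [M > 0] at [x0] is [U_M (x - x0)], and the energy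
    [U'^2/2 + F(U) = F(M)], evaluated where [U] vanishes, gives [F(M) >= 0].
    If [F(pM) < 0] no such [M] exists.
    If [F(pM) > 0], [L0] is the infimum of the lengths [L] for which some [U_M]
    with [F(M) > 0], [M < pM] reaches zero within time [L/2].  As [M] increases
    to the equilibrium [pM], the minimum of [U_M] over [[0, L/2]] varies
    continuously up to [pM > 0], so for [L > L0] it vanishes for some [M]; as
    zeros of positive energy are transversal, this zero is at [L/2]. *)

(** The time an orbit needs to come down to zero need not be monotone in [M], so [L0] cannot be read
    off from one distinguished orbit. Asking only that zero be reached by time [L/2] makes the set
    of lengths upward closed; landing exactly at [L/2] is restored afterwards by raising [M]. Zero
    energy is kept out of that set because such an orbit may touch zero tangentially and rise again.
    In the bistable case solutions of zero energy can occur, so nonexistence below [L0] needs a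
    perturbation: a slightly larger [M] has positive energy and costs arbitrarily little extra
    length. The bound [PI / sqrt K] comes from [- u'' <= K u]: on an interval carrying a positive
    solution, [K] is at least the first Dirichlet eigenvalue [(PI / L)^2]. *)

(** * Lipschitz functions and integrals against an exponential weight *)

Definition globally_lipschitz (C : R) (g : R -> R) : Prop :=
  forall p q : R, Rabs (g p - g q) <= C * Rabs (p - q).

Lemma globally_lipschitz_nonneg (C : R) (g : R -> R) :
  globally_lipschitz C g -> 0 <= C.
Proof.
  intros Hg. specialize (Hg 1 0).
  rewrite Rminus_0_r, Rabs_R1 in Hg.
  pose proof (Rabs_pos (g 1 - g 0)). lra.
Qed.

Lemma globally_lipschitz_continuous (C : R) (g : R -> R) :
  globally_lipschitz C g -> forall x : R, continuous g x.
Proof.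
  intros Hg x. pose proof (globally_lipschitz_nonneg _ _ Hg) as HC.
  apply continuity_pt_filterlim.
  intros eps Heps. exists (eps / (C + 1)). split.
  - apply Rdiv_lt_0_compat; lra.
  - intros y [_ Hy]. unfold dist in *; simpl in *; unfold Rdist in *.
    apply Rle_lt_trans with (1 := Hg y x).
    assert (H : (C + 1) * Rabs (y - x) < eps).
    { apply Rmult_lt_compat_l with (r := C + 1) in Hy; [|lra].
      replace ((C + 1) * (eps / (C + 1))) with eps in Hy by (field; lra).
      exact Hy. }
    pose proof (Rabs_pos (y - x)). nra.
Qed.

Lemma is_derive_continuity_pt (f : R -> R) (x l : R) :
  is_derive f x l -> continuity_pt f x.
Proof.
  intros H. apply continuity_pt_filterlim.
  apply (ex_derive_continuous (V := R_NormedModule)). now exists l.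
Qed.

Lemma RInt_is_derive (h : R -> R) :
  (forall x : R, continuous h x) ->
  forall x : R, is_derive (fun t => RInt h 0 t) x (h x).
Proof.
  intros Hh x. apply is_derive_RInt with (a := 0); [|apply Hh].
  exists (mkposreal 1 Rlt_0_1). intros y _.
  apply (RInt_correct (V := R_CompleteNormedModule)). apply (ex_RInt_continuous (V := R_CompleteNormedModule)). intros z _. apply Hh.
Qed.

Lemma RInt_continuous (h : R -> R) :
  (forall x : R, continuous h x) ->
  forall x : R, continuous (fun t => RInt h 0 t) x.
Proof.
  intros Hh x. apply continuity_pt_filterlim.
  apply is_derive_continuity_pt with (h x). now apply RInt_is_derive.
Qed.

Lemma exp_ge_1 (x : R) : 0 <= x -> 1 <= exp x.
Proof. intros Hx. pose proof (exp_ineq1_le x). lra. Qed.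

(** Each integration from 0 gains a factor [1 / lam] against the weight; the two integrations in
    [picard_map] therefore gain [1 / lam^2], which beats the Lipschitz constant once [lam] is
    large. *)
Lemma RInt_exp_bound (h : R -> R) (B lam : R) :
  0 < lam -> (forall x : R, continuous h x) ->
  (forall x : R, Rabs (h x) <= B * exp (lam * Rabs x)) ->
  forall x : R, Rabs (RInt h 0 x) <= B / lam * exp (lam * Rabs x).
Proof.
  intros Hlam Hc Hb x.
  assert (HB : 0 <= B).
  { specialize (Hb 0). rewrite Rabs_R0, Rmult_0_r, exp_0 in Hb.
    pose proof (Rabs_pos (h 0)). lra. }
  assert (HBl : 0 <= B / lam) by (apply Rdiv_le_0_compat; lra).
  assert (Hex : forall a b, ex_RInt h a b).
  { intros a b. apply (ex_RInt_continuous (V := R_CompleteNormedModule)). intros; apply Hc. }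
  destruct (Rle_dec 0 x) as [Hx|Hx].
  - assert (Hn : norm (RInt h 0 x : R_NormedModule)
       <= minus (B / lam * exp (lam * x)) (B / lam * exp (lam * 0))).
    { apply (norm_RInt_le h (fun t => B * exp (lam * t)) 0 x); trivial.
      - intros t Ht. specialize (Hb t). rewrite (Rabs_pos_eq t) in Hb by lra.
        exact Hb.
      - apply (RInt_correct (V := R_CompleteNormedModule)). apply Hex.
      - apply (is_RInt_derive (fun t => B / lam * exp (lam * t))).
        + intros t _. auto_derive; trivial. field. lra.
        + intros t _. apply (ex_derive_continuous (V := R_NormedModule)). auto_derive. trivial. }
    rewrite (Rabs_pos_eq x) by lra.
    change (Rabs (RInt h 0 x) <=
      B / lam * exp (lam * x) + - (B / lam * exp (lam * 0))) in Hn.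
    rewrite Rmult_0_r, exp_0 in Hn. lra.
  - assert (Hn : norm (RInt h x 0 : R_NormedModule)
       <= minus (- (B / lam) * exp (- lam * 0)) (- (B / lam) * exp (- lam * x))).
    { apply (norm_RInt_le h (fun t => B * exp (- lam * t)) x 0); [lra| | |].
      - intros t Ht. specialize (Hb t). rewrite (Rabs_left1 t) in Hb by lra.
        replace (- lam * t) with (lam * - t) by ring. exact Hb.
      - apply (RInt_correct (V := R_CompleteNormedModule)). apply Hex.
      - apply (is_RInt_derive (fun t => - (B / lam) * exp (- lam * t))).
        + intros t _. auto_derive; trivial. field. lra.
        + intros t _. apply (ex_derive_continuous (V := R_NormedModule)). auto_derive. trivial. }
    rewrite <- (opp_RInt_swap h x 0) by apply Hex.
    change (opp (RInt h x 0)) with (- RInt h x 0). rewrite Rabs_Ropp.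
    rewrite (Rabs_left1 x) by lra.
    change (Rabs (RInt h x 0) <=
      - (B / lam) * exp (- lam * 0) + - (- (B / lam) * exp (- lam * x))) in Hn.
    rewrite Rmult_0_r, exp_0 in Hn.
    replace (lam * - x) with (- lam * x) by ring. lra.
Qed.

(** * Global existence and stability for [u'' = - g(u)] *)

Definition is_orbit (g : R -> R) (M : R) (U V : R -> R) : Prop :=
  U 0 = M /\ V 0 = 0 /\
  (forall x : R, is_derive U x (V x)) /\
  (forall x : R, is_derive V x (- g (U x))).

Definition picard_map (g : R -> R) (M : R) (u : R -> R) : R -> R :=
  fun x => M - RInt (fun t => RInt (fun s => g (u s)) 0 t) 0 x.

Lemma continuous_comp_all (g u : R -> R) :
  (forall x : R, continuous g x) -> (forall x : R, continuous u x) ->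
  forall x : R, continuous (fun s => g (u s)) x.
Proof.
  intros Hg Hu x. apply continuous_comp; [apply Hu|apply Hg].
Qed.

Lemma picard_map_continuous (g : R -> R) (M : R) (u : R -> R) :
  (forall x : R, continuous g x) -> (forall x : R, continuous u x) ->
  forall x : R, continuous (picard_map g M u) x.
Proof.
  intros Hg Hu x.
  apply (continuous_minus (V := R_NormedModule) (fun _ => M)).
  - apply continuous_const.
  - apply RInt_continuous. apply RInt_continuous.
    now apply continuous_comp_all.
Qed.

(* With the weight [exp (lam |x|)], [lam^2 >= 2 C], the map is a 1/2-contraction
   on the whole line, so that no continuation of local solutions is needed. *)
Lemma picard_map_contraction (g : R -> R) (C lam M B : R) (u v : R -> R) :
  globally_lipschitz C g -> 0 < lam -> 2 * C <= lam * lam -> 0 <= B ->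
  (forall x : R, continuous u x) -> (forall x : R, continuous v x) ->
  (forall x : R, Rabs (u x - v x) <= B * exp (lam * Rabs x)) ->
  forall x : R,
    Rabs (picard_map g M u x - picard_map g M v x)
      <= B / 2 * exp (lam * Rabs x).
Proof.
  intros Hg Hlam HC HB Hu Hv Huv x.
  pose proof (globally_lipschitz_continuous _ _ Hg) as Hgc.
  pose proof (globally_lipschitz_nonneg _ _ Hg) as HC0.
  assert (Hcu := continuous_comp_all g u Hgc Hu).
  assert (Hcv := continuous_comp_all g v Hgc Hv).
  set (h := fun s => minus (g (u s)) (g (v s))).
  assert (Hh : forall t, continuous h t).
  { intros t. now apply (continuous_minus (V := R_NormedModule)). }
  assert (Hex : forall k : R -> R, (forall t, continuous k t) ->
            forall a b, ex_RInt k a b).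
  { intros k Hk a b. apply (ex_RInt_continuous (V := R_CompleteNormedModule)). intros; apply Hk. }
  replace (picard_map g M u x - picard_map g M v x)
    with (- RInt (fun t => RInt h 0 t) 0 x).
  - rewrite Rabs_Ropp.
    apply Rle_trans with (C * B / lam / lam * exp (lam * Rabs x)).
    + apply RInt_exp_bound; trivial.
      * now apply RInt_continuous.
      * apply RInt_exp_bound; trivial.
        intros s. apply Rle_trans with (1 := Hg (u s) (v s)).
        rewrite Rmult_assoc. apply Rmult_le_compat_l; trivial.
    + apply Rmult_le_compat_r; [left; apply exp_pos|].
      apply Rmult_le_reg_r with (lam * lam); [nra|].
      replace (C * B / lam / lam * (lam * lam)) with (C * B) by (field; lra).
      nra.
  - unfold picard_map, h.
    rewrite (RInt_ext _ (fun t => minus (RInt (fun s => g (u s)) 0 t)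
                                        (RInt (fun s => g (v s)) 0 t))).
    + rewrite (RInt_minus (V := R_CompleteNormedModule));
        try (apply Hex; now apply RInt_continuous).
      change (- (RInt (fun t => RInt (fun s => g (u s)) 0 t) 0 x
               + - RInt (fun t => RInt (fun s => g (v s)) 0 t) 0 x) =
        M - RInt (fun t => RInt (fun s => g (u s)) 0 t) 0 x -
        (M - RInt (fun t => RInt (fun s => g (v s)) 0 t) 0 x)). ring.
    + intros t _. apply (RInt_minus (V := R_CompleteNormedModule)); now apply Hex.
Qed.

Fixpoint picard_iter (g : R -> R) (M : R) (n : nat) : R -> R :=
  match n with
  | O => fun _ => M
  | S k => picard_map g M (picard_iter g M k)
  end.

Lemma picard_iter_continuous (g : R -> R) (M : R) (n : nat) :
  (forall x : R, continuous g x) ->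
  forall x : R, continuous (picard_iter g M n) x.
Proof.
  intros Hg. induction n as [|n IH]; simpl.
  - intros x. apply continuous_const.
  - now apply picard_map_continuous.
Qed.

Lemma geometric_small (A eps : R) :
  0 < eps -> exists n : nat, forall m : nat, (n <= m)%nat -> A * (1/2)^m < eps.
Proof.
  intros Heps.
  destruct (pow_lt_1_zero (1/2)) with (y := eps / (Rabs A + 1)) as [n Hn].
  - rewrite Rabs_pos_eq; lra.
  - apply Rdiv_lt_0_compat; trivial. pose proof (Rabs_pos A). lra.
  - exists n. intros m Hm. specialize (Hn m Hm).
    pose proof (Rabs_pos A) as HA. pose proof (Rle_abs A) as HA'.
    assert (Hp : 0 < (1/2)^m) by (apply pow_lt; lra).
    rewrite Rabs_pos_eq in Hn by lra.
    apply Rmult_lt_compat_l with (r := Rabs A + 1) in Hn; [|lra].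
    replace ((Rabs A + 1) * (eps / (Rabs A + 1))) with eps in Hn
      by (field; lra). nra.
Qed.

(** The iterates converge geometrically in the weighted norm. The weight is bounded on bounded
    intervals, so convergence is locally uniform there and the limit is continuous. *)
Lemma picard_limit (g : R -> R) (C M : R) :
  globally_lipschitz C g ->
  exists u : R -> R,
    (forall x : R, continuous u x) /\ (forall x : R, u x = picard_map g M u x).
Proof.
  intros Hg.
  pose proof (globally_lipschitz_nonneg _ _ Hg) as HC.
  pose proof (globally_lipschitz_continuous _ _ Hg) as Hgc.
  (* Positive even for [C = 0], and [(2 C + 1)^2 >= 2 C]. *)
  set (lam := 2 * C + 1).
  assert (Hlam : 0 < lam) by (unfold lam; lra).
  assert (HClam : 2 * C <= lam * lam) by (unfold lam; nra).
  set (w := fun n => picard_iter g M n).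
  assert (Hwc : forall n x, continuous (w n) x).
  { intros n. now apply picard_iter_continuous. }
  (* The first increment is a double integral of the constant [g M]; [RInt_exp_bound] applied twice
     yields this constant. *)
  set (B := Rabs (g M) / lam / lam).
  assert (HB : 0 <= B).
  { unfold B. repeat apply Rdiv_le_0_compat; trivial. apply Rabs_pos. }
  assert (Hpow : forall n, 0 < (1/2)^n) by (intros; apply pow_lt; lra).
  assert (Hstep : forall n x,
    Rabs (w (S n) x - w n x) <= B * (1/2)^n * exp (lam * Rabs x)).
  { induction n as [|n IH]; intros x.
    - replace (w 1%nat x - w O x)
        with (- RInt (fun t => RInt (fun _ => g M) 0 t) 0 x)
        by (unfold w; simpl; unfold picard_map; ring).
      rewrite Rabs_Ropp. simpl pow. rewrite Rmult_1_r. unfold B.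
      apply RInt_exp_bound; trivial.
      + apply RInt_continuous. intros; apply continuous_const.
      + apply RInt_exp_bound; trivial.
        * intros; apply continuous_const.
        * intros y. rewrite <- (Rmult_1_r (Rabs (g M))) at 1.
          apply Rmult_le_compat_l; [apply Rabs_pos|].
          apply exp_ge_1. pose proof (Rabs_pos y). nra.
    - change (w (S (S n))) with (picard_map g M (w (S n))).
      change (w (S n)) with (picard_map g M (w n)) at 2.
      replace (B * (1/2)^(S n)) with (B * (1/2)^n / 2) by (simpl; field).
      apply picard_map_contraction with C; trivial.
      specialize (Hpow n). nra. }
  clearbody B.
  (* The factor [1 - (1/2)^k] is the exact partial geometric sum; without it the induction on [k]
     would not close. *)
  assert (Htail : forall n k x,
    Rabs (w (n + k)%nat x - w n x) <=
      2 * B * (1/2)^n * (1 - (1/2)^k) * exp (lam * Rabs x)).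
  { intros n k x. induction k as [|k IH].
    - rewrite Nat.add_0_r. simpl. rewrite !Rminus_diag, Rabs_R0. lra.
    - rewrite Nat.add_succ_r.
      replace (w (S (n + k)) x - w n x)
        with ((w (S (n + k)) x - w (n + k)%nat x) + (w (n + k)%nat x - w n x))
        by ring.
      apply Rle_trans with (1 := Rabs_triang _ _).
      specialize (Hstep (n + k)%nat x). rewrite pow_add in Hstep. simpl. lra. }
  assert (Hcauchy : forall x, ex_finite_lim_seq (fun n => w n x)).
  { intros x. apply ex_lim_seq_cauchy_corr. intros eps.
    destruct (geometric_small (2 * (2 * B * exp (lam * Rabs x))) eps
                (cond_pos eps)) as [N HN].
    exists N.
    assert (HNb : forall n, (N <= n)%nat ->
              Rabs (w n x - w N x) <= 2 * B * exp (lam * Rabs x) * (1/2)^N).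
    { intros n Hn. replace n with (N + (n - N))%nat by lia.
      apply Rle_trans with (1 := Htail N (n - N)%nat x).
      pose proof (exp_pos (lam * Rabs x)) as He.
      pose proof (Hpow N). pose proof (Hpow (n - N)%nat).
      assert (0 <= B * exp (lam * Rabs x) * (1/2)^N * (1/2)^(n-N)).
      { apply Rlt_le in He. repeat apply Rmult_le_pos; lra. }
      lra. }
    intros n m Hn Hm.
    replace (w n x - w m x) with ((w n x - w N x) + - (w m x - w N x)) by ring.
    apply Rle_lt_trans with (1 := Rabs_triang _ _). rewrite Rabs_Ropp.
    specialize (HN N (Nat.le_refl N)).
    pose proof (HNb n Hn). pose proof (HNb m Hm). lra. }
  set (u := fun x => real (Lim_seq (fun n => w n x))).
  assert (Hlim : forall x, is_lim_seq (fun n => w n x) (u x)).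
  { intros x. apply Lim_seq_correct'. apply Hcauchy. }
  assert (Hrate : forall n x,
    Rabs (u x - w n x) <= 2 * B * (1/2)^n * exp (lam * Rabs x)).
  { intros n x.
    assert (Hl : is_lim_seq (fun k => Rabs (w (n + k)%nat x - w n x))
                   (Rabs (u x - w n x))).
    { apply (is_lim_seq_abs _ (u x - w n x)).
      apply is_lim_seq_minus'; [|apply is_lim_seq_const].
      apply is_lim_seq_ext with (fun k => w (k + n)%nat x).
      - intros k. now rewrite Nat.add_comm.
      - apply (is_lim_seq_incr_n (fun k => w k x)). apply Hlim. }
    refine (is_lim_seq_le _ _ _ (2 * B * (1/2)^n * exp (lam * Rabs x))
              _ Hl (is_lim_seq_const _)).
    intros k. specialize (Htail n k x).
    pose proof (exp_pos (lam * Rabs x)) as He.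
    pose proof (Hpow n). pose proof (Hpow k).
    assert (0 <= B * exp (lam * Rabs x) * (1/2)^n * (1/2)^k).
    { apply Rlt_le in He. repeat apply Rmult_le_pos; lra. }
    lra. }
  assert (Huc : forall x, continuous u x).
  { intros x. apply continuity_pt_filterlim.
    pose proof (Rabs_pos x) as Hx0.
    assert (Hr : 0 < Rabs x + 1) by lra.
    apply (CVU_continuity w u 0 (mkposreal _ Hr)).
    - intros eps Heps.
      destruct (geometric_small (2 * B * exp (lam * (Rabs x + 1))) eps Heps)
        as [N HN].
      exists N. intros n y Hn Hy. unfold Boule in Hy; simpl in Hy.
      rewrite Rminus_0_r in Hy.
      apply Rle_lt_trans with (1 := Hrate n y).
      apply Rle_lt_trans with (2 := HN n Hn).
      replace (2 * B * exp (lam * (Rabs x + 1)) * (1 / 2) ^ n)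
        with (2 * B * (1/2)^n * exp (lam * (Rabs x + 1))) by ring.
      apply Rmult_le_compat_l.
      + specialize (Hpow n). nra.
      + left. apply exp_increasing. nra.
    - intros n y _. apply continuity_pt_filterlim. apply Hwc.
    - unfold Boule; simpl. rewrite Rminus_0_r. lra. }
  exists u. split; trivial.
  intros x. apply cond_eq. intros eps Heps.
  destruct (geometric_small (2 * B * exp (lam * Rabs x)) eps Heps) as [N HN].
  (* Each of the two pieces is at most [B (1/2)^N] times the weight, and their sum is the quantity
     that [HN] puts below [eps]. *)
  replace (u x - picard_map g M u x)
    with ((u x - w (S N) x) + - (picard_map g M u x - picard_map g M (w N) x))
    by (unfold w; simpl; ring).
  apply Rle_lt_trans with (1 := Rabs_triang _ _). rewrite Rabs_Ropp.
  assert (H1 := Hrate (S N) x).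
  assert (H2 : Rabs (picard_map g M u x - picard_map g M (w N) x)
                 <= 2 * B * (1/2)^N / 2 * exp (lam * Rabs x)).
  { apply picard_map_contraction with C; trivial.
    specialize (Hpow N). nra. }
  specialize (HN N (Nat.le_refl N)). simpl in H1. lra.
Qed.

Lemma orbit_exists (g : R -> R) (C M : R) :
  globally_lipschitz C g -> exists U V : R -> R, is_orbit g M U V.
Proof.
  intros Hg.
  pose proof (globally_lipschitz_continuous _ _ Hg) as Hgc.
  destruct (picard_limit g C M Hg) as [u [Hc Hfix]].
  assert (Hgu := continuous_comp_all g u Hgc Hc).
  exists u, (fun x => - RInt (fun s => g (u s)) 0 x).
  split; [|split; [|split]].
  - rewrite Hfix. unfold picard_map. rewrite RInt_point.
    change (M - 0 = M). ring.
  - rewrite RInt_point. change (- 0 = 0). ring.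
  - intros x. apply is_derive_ext with (picard_map g M u).
    + intros t. now rewrite <- Hfix.
    + unfold picard_map.
      replace (- RInt (fun s => g (u s)) 0 x)
        with (minus 0 (RInt (fun s => g (u s)) 0 x))
        by (unfold minus, plus, opp; simpl; ring).
      apply (is_derive_minus (V := R_NormedModule) (fun _ => M)).
      * apply (is_derive_const (V := R_NormedModule)).
      * apply (RInt_is_derive (fun t => RInt (fun s => g (u s)) 0 t)).
        now apply RInt_continuous.
  - intros x. apply (is_derive_opp (V := R_NormedModule)).
    now apply (RInt_is_derive (fun s => g (u s))).
Qed.

(** The bound makes [W x * exp (- k x)] nonincreasing and [W x * exp (k x)] nondecreasing. The
    second half propagates estimates backwards, for points to the left of the base point. *)
Lemma gronwall_two_sided (W dW : R -> R) (k a b : R) :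
  a <= b ->
  (forall x : R, a <= x <= b -> is_derive W x (dW x)) ->
  (forall x : R, a <= x <= b -> Rabs (dW x) <= k * W x) ->
  W b <= W a * exp (k * (b - a)) /\ W a <= W b * exp (k * (b - a)).
Proof.
  intros Hab HW Hk.
  assert (Hc : forall x, a <= x <= b -> continuity_pt W x).
  { intros x Hx. apply is_derive_continuity_pt with (dW x). auto. }
  assert (Hexp : forall m x, is_derive (fun t => W t * exp (m * t)) x
     ((dW x + m * W x) * exp (m * x)) \/ ~ (a <= x <= b)).
  { intros m x. destruct (Rle_dec a x); [|right; lra].
    destruct (Rle_dec x b); [left|right; lra].
    assert (H1 := HW x (conj r r0)).
    auto_derive.
    - now exists (dW x).
    - rewrite (is_derive_unique (fun t : R => W t) _ _ H1). ring. }
  (* Mean value theorem for [W t * exp (m t)], to be used with [m = - k] and [m = k]. *)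
  assert (Hm : forall m, exists c, a <= c <= b /\
     W b * exp (m * b) - W a * exp (m * a)
       = (dW c + m * W c) * exp (m * c) * (b - a)).
  { intros m.
    destruct (MVT_gen (fun t => W t * exp (m * t)) a b
       (fun x => (dW x + m * W x) * exp (m * x))) as [c [Hc1 Hc2]].
    - intros x. rewrite Rmin_left, Rmax_right by lra. intros Hx.
      destruct (Hexp m x); [trivial|lra].
    - intros x. rewrite Rmin_left, Rmax_right by lra. intros Hx.
      destruct (Hexp m x) as [H|H]; [|lra].
      now apply is_derive_continuity_pt in H.
    - rewrite Rmin_left, Rmax_right in Hc1 by lra. now exists c. }
  assert (Hsplit : forall p q, exp (p + q) = exp p * exp q) by apply exp_plus.
  split.
  - destruct (Hm (- k)) as [c [Hc1 Hc2]].
    specialize (Hk c Hc1). pose proof (Rle_abs (dW c)).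
    assert (H1 : (dW c + - k * W c) * exp (- k * c) * (b - a) <= 0).
    { pose proof (exp_pos (- k * c)).
      assert ((dW c + - k * W c) * exp (- k * c) <= 0) by nra. nra. }
    replace (k * (b - a)) with (k * b + - k * a) by ring. rewrite Hsplit.
    replace (W b) with (W b * exp (- k * b) * exp (k * b)).
    + pose proof (exp_pos (k * b)). nra.
    + rewrite Rmult_assoc, <- Hsplit.
      replace (- k * b + k * b) with 0 by ring. rewrite exp_0. ring.
  - destruct (Hm k) as [c [Hc1 Hc2]].
    specialize (Hk c Hc1). pose proof (Rcomplements.Rabs_maj2 (dW c)).
    assert (H1 : 0 <= (dW c + k * W c) * exp (k * c) * (b - a)).
    { pose proof (exp_pos (k * c)).
      assert (0 <= (dW c + k * W c) * exp (k * c)) by nra. nra. }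
    replace (k * (b - a)) with (k * b + - k * a) by ring. rewrite Hsplit.
    replace (W a) with (W a * exp (k * a) * exp (- k * a)).
    + pose proof (exp_pos (- k * a)). nra.
    + rewrite Rmult_assoc, <- Hsplit.
      replace (k * a + - k * a) with 0 by ring. rewrite exp_0. ring.
Qed.

(** Gronwall for the squared distance [W] in the phase plane: [2 a b <= a^2 + b^2] gives
    [|W'| <= (1 + C) W]. The interval is open because a Dirichlet solution is differentiable only
    inside [(0, L)]. *)
Lemma ode_stability (g : R -> R) (C c d x0 : R) (u v p q : R -> R) :
  globally_lipschitz C g -> c < x0 < d ->
  (forall x : R, c < x < d -> is_derive u x (v x)) ->
  (forall x : R, c < x < d -> is_derive v x (- g (u x))) ->
  (forall x : R, c < x < d -> is_derive p x (q x)) ->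
  (forall x : R, c < x < d -> is_derive q x (- g (p x))) ->
  forall x : R, c < x < d ->
    (u x - p x) ^ 2 + (v x - q x) ^ 2 <=
    ((u x0 - p x0) ^ 2 + (v x0 - q x0) ^ 2) * exp ((1 + C) * Rabs (x - x0)).
Proof.
  intros Hg Hx0 Hu Hv Hp Hq x Hx.
  pose proof (globally_lipschitz_nonneg _ _ Hg) as HC.
  set (W := fun x => (u x - p x) ^ 2 + (v x - q x) ^ 2).
  set (dW := fun x => 2 * (u x - p x) * (v x - q x)
                    + 2 * (v x - q x) * (- g (u x) + g (p x))).
  assert (HW : forall t, c < t < d -> is_derive W t (dW t)).
  { intros t Ht. specialize (Hu t Ht). specialize (Hv t Ht).
    specialize (Hp t Ht). specialize (Hq t Ht).
    unfold W, dW. auto_derive.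
    - repeat split; eexists; eassumption.
    - rewrite (is_derive_unique (fun s : R => u s) _ _ Hu),
        (is_derive_unique (fun s : R => v s) _ _ Hv),
        (is_derive_unique (fun s : R => p s) _ _ Hp),
        (is_derive_unique (fun s : R => q s) _ _ Hq). ring. }
  assert (HdW : forall t, Rabs (dW t) <= (1 + C) * W t).
  { intros t. unfold dW, W. specialize (Hg (u t) (p t)).
    replace (2 * (u t - p t) * (v t - q t) +
             2 * (v t - q t) * (- g (u t) + g (p t)))
      with (2 * (v t - q t) * ((u t - p t) - (g (u t) - g (p t)))) by ring.
    rewrite !Rabs_mult, (Rabs_pos_eq 2) by lra.
    rewrite <- (pow2_abs (u t - p t)), <- (pow2_abs (v t - q t)).
    assert (H : Rabs (u t - p t - (g (u t) - g (p t)))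
                <= (1 + C) * Rabs (u t - p t)).
    { eapply Rle_trans; [apply Rabs_triang|]. rewrite Rabs_Ropp. lra. }
    pose proof (Rabs_pos (v t - q t)) as Ha.
    pose proof (Rabs_pos (u t - p t)) as Hb.
    set (a := Rabs (v t - q t)) in *. set (b := Rabs (u t - p t)) in *.
    apply Rle_trans with (2 * a * ((1 + C) * b)).
    - apply Rmult_le_compat_l; lra.
    - pose proof (pow2_ge_0 (a - b)). nra. }
  fold (W x). fold (W x0).
  destruct (Rle_dec x0 x) as [Hle|Hle].
  - rewrite Rabs_pos_eq by lra.
    apply (gronwall_two_sided W dW); trivial.
    intros; apply HW; lra.
  - rewrite Rabs_left1 by lra.
    replace (- (x - x0)) with (x0 - x) by ring.
    apply (gronwall_two_sided W dW); trivial; try lra.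
    intros; apply HW; lra.
Qed.

(** * Derivative tests at extrema *)

Lemma mean_value (u v : R -> R) (a b : R) :
  a < b -> (forall x : R, a <= x <= b -> is_derive u x (v x)) ->
  exists c : R, a < c < b /\ u b - u a = v c * (b - a).
Proof.
  intros Hab H. destruct (MVT_cor2 u v a b Hab) as [c [Hc1 Hc2]].
  - intros x Hx. apply is_derive_Reals. auto.
  - now exists c.
Qed.

Lemma derive_pos_near (v : R -> R) (y l : R) :
  is_derive v y l -> 0 < l ->
  exists delta : R, 0 < delta /\
    forall t : R, t <> y -> Rabs (t - y) < delta -> 0 < (v t - v y) * (t - y).
Proof.
  intros Hv Hl. apply is_derive_Reals in Hv.
  destruct (Hv l Hl) as [delta Hd].
  exists delta. split; [apply cond_pos|].
  intros t Hne Ht. assert (Hh : t - y <> 0) by lra.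
  specialize (Hd (t - y) Hh Ht). replace (y + (t - y)) with t in Hd by ring.
  apply Rabs_lt_between in Hd.
  assert (Hq : 0 < (v t - v y) / (t - y)) by lra.
  replace ((v t - v y) * (t - y))
    with ((v t - v y) / (t - y) * ((t - y) * (t - y))) by (field; lra).
  apply Rmult_lt_0_compat; trivial. nra.
Qed.

Lemma derive_zero_at_max (u : R -> R) (a b x0 l : R) :
  a < x0 < b -> is_derive u x0 l ->
  (forall x : R, a < x < b -> u x <= u x0) -> l = 0.
Proof.
  intros Hx0 Hu Hmax.
  destruct (Rtotal_order l 0) as [Hl|[Hl|Hl]]; trivial; exfalso.
  - destruct (derive_pos_near (fun x => - u x) x0 (- l)) as [d [Hd1 Hd2]].
    + now apply (is_derive_opp (V := R_NormedModule)).
    + lra.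
    + set (t := Rmin (d / 2) ((x0 - a) / 2)).
      assert (0 < t) by (apply Rmin_glb_lt; lra).
      assert (t <= d / 2) by apply Rmin_l.
      assert (t <= (x0 - a) / 2) by apply Rmin_r.
      specialize (Hd2 (x0 - t)).
      replace (x0 - t - x0) with (- t) in Hd2 by ring.
      rewrite Rabs_Ropp, Rabs_pos_eq in Hd2 by lra.
      specialize (Hmax (x0 - t)). nra.
  - destruct (derive_pos_near u x0 l Hu Hl) as [d [Hd1 Hd2]].
    set (t := Rmin (d / 2) ((b - x0) / 2)).
    assert (0 < t) by (apply Rmin_glb_lt; lra).
    assert (t <= d / 2) by apply Rmin_l.
    assert (t <= (b - x0) / 2) by apply Rmin_r.
    specialize (Hd2 (x0 + t)).
    replace (x0 + t - x0) with t in Hd2 by ring.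
    rewrite Rabs_pos_eq in Hd2 by lra.
    specialize (Hmax (x0 + t)). nra.
Qed.

Lemma derive_zero_at_min (u : R -> R) (a b x0 l : R) :
  a < x0 < b -> is_derive u x0 l ->
  (forall x : R, a < x < b -> u x0 <= u x) -> l = 0.
Proof.
  intros Hx0 Hu Hmin.
  assert (H : - l = 0); [|lra].
  apply (derive_zero_at_max (fun x => - u x) a b x0); trivial.
  - now apply (is_derive_opp (V := R_NormedModule)).
  - intros x Hx. specialize (Hmin x Hx). lra.
Qed.

(** If [l] were positive, [v] would be positive just to the right of [x0], and the mean value
    theorem would lift [u] above its maximum. *)
Lemma second_derive_at_max (u v : R -> R) (a b x0 l : R) :
  a < x0 < b -> (forall x : R, a < x < b -> is_derive u x (v x)) ->
  is_derive v x0 l -> (forall x : R, a < x < b -> u x <= u x0) ->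
  v x0 = 0 /\ l <= 0.
Proof.
  intros Hx0 Hu Hv Hmax.
  assert (Hv0 : v x0 = 0).
  { apply (derive_zero_at_max u a b x0); auto. }
  split; trivial.
  apply Rnot_lt_le. intros Hl.
  destruct (derive_pos_near v x0 l Hv Hl) as [d [Hd1 Hd2]].
  set (t := Rmin (d / 2) ((b - x0) / 2)).
  assert (0 < t) by (apply Rmin_glb_lt; lra).
  assert (t <= d / 2) by apply Rmin_l.
  assert (t <= (b - x0) / 2) by apply Rmin_r.
  destruct (mean_value u v x0 (x0 + t)) as [c [Hc1 Hc2]]; [lra| |].
  - intros x Hx. apply Hu. lra.
  - specialize (Hd2 c). rewrite Rabs_pos_eq, Hv0 in Hd2 by lra.
    specialize (Hmax (x0 + t)). nra.
Qed.

(** * Energy and the shape of orbits *)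

Definition potential (g : R -> R) (p : R) : R := RInt g 0 p.

Lemma potential_0 (g : R -> R) : potential g 0 = 0.
Proof. unfold potential. rewrite RInt_point. reflexivity. Qed.

Lemma is_derive_potential (g : R -> R) (C p : R) :
  globally_lipschitz C g -> is_derive (potential g) p (g p).
Proof.
  intros Hg. apply (RInt_is_derive g).
  now apply globally_lipschitz_continuous with C.
Qed.

Lemma potential_increasing (g : R -> R) (C p q : R) :
  globally_lipschitz C g -> p < q ->
  (forall x : R, p < x < q -> 0 < g x) -> potential g p < potential g q.
Proof.
  intros Hg Hpq Hpos.
  destruct (mean_value (potential g) g p q Hpq) as [c [Hc1 Hc2]].
  - intros x _. now apply is_derive_potential with C.
  - specialize (Hpos c Hc1). nra.
Qed.

Lemma potential_decreasing (g : R -> R) (C p q : R) :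
  globally_lipschitz C g -> p < q ->
  (forall x : R, p < x < q -> g x < 0) -> potential g q < potential g p.
Proof.
  intros Hg Hpq Hneg.
  destruct (mean_value (potential g) g p q Hpq) as [c [Hc1 Hc2]].
  - intros x _. now apply is_derive_potential with C.
  - specialize (Hneg c Hc1). nra.
Qed.

Lemma orbit_continuity_pt (g : R -> R) (M : R) (U V : R -> R) (x : R) :
  is_orbit g M U V -> continuity_pt U x.
Proof.
  intros (_ & _ & HU & _). apply is_derive_continuity_pt with (V x). apply HU.
Qed.

Lemma is_derive_zero_const (E : R -> R) :
  (forall x : R, is_derive E x 0) -> forall x : R, E x = E 0.
Proof.
  intros HE x. destruct (Rtotal_order x 0) as [Hx|[Hx|Hx]].
  - apply (eq_is_derive E x 0); [intros; apply HE|trivial].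
  - f_equal. exact Hx.
  - symmetry. apply (eq_is_derive E 0 x); [intros; apply HE|trivial].
Qed.

Lemma orbit_energy (g : R -> R) (C M : R) (U V : R -> R) :
  globally_lipschitz C g -> is_orbit g M U V ->
  forall x : R, V x ^ 2 / 2 + potential g (U x) = potential g M.
Proof.
  intros Hg (HU0 & HV0 & HU & HV) x.
  set (E := fun x => V x ^ 2 / 2 + potential g (U x)).
  assert (HE : forall t, is_derive E t 0).
  { intros t. specialize (HU t). specialize (HV t).
    assert (HF := is_derive_potential g C (U t) Hg).
    unfold E. auto_derive.
    - repeat split; eexists; eassumption.
    - rewrite (is_derive_unique (fun s : R => U s) _ _ HU),
        (is_derive_unique (fun s : R => V s) _ _ HV),
        (is_derive_unique (fun s : R => potential g s) _ _ HF). field. }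
  change (E x = potential g M). rewrite (is_derive_zero_const E HE).
  unfold E. rewrite HU0, HV0. field.
Qed.

Lemma orbit_dependence (g : R -> R) (C M N : R) (U V P Q : R -> R) (x : R) :
  globally_lipschitz C g -> is_orbit g M U V -> is_orbit g N P Q ->
  Rabs (U x - P x) <= Rabs (M - N) * exp ((1 + C) * Rabs x) /\
  Rabs (V x - Q x) <= Rabs (M - N) * exp ((1 + C) * Rabs x).
Proof.
  intros Hg (HU0 & HV0 & HU & HV) (HP0 & HQ0 & HP & HQ).
  pose proof (globally_lipschitz_nonneg _ _ Hg) as HC.
  pose proof (Rabs_pos x) as Hx.
  assert (H := ode_stability g C (- (Rabs x + 1)) (Rabs x + 1) 0 U V P Q Hg).
  assert (Hx' : - (Rabs x + 1) < x < Rabs x + 1).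
  { apply Rabs_lt_between. lra. }
  assert (H' := H ltac:(lra) (fun t _ => HU t) (fun t _ => HV t)
                  (fun t _ => HP t) (fun t _ => HQ t) x Hx'). clear H.
  rewrite HU0, HV0, HP0, HQ0, !Rminus_0_r in H'.
  set (e := exp ((1 + C) * Rabs x)) in *.
  assert (He : 1 <= e).
  { apply exp_ge_1. nra. }
  assert (Hr : 0 <= Rabs (M - N) * e).
  { apply Rmult_le_pos; [apply Rabs_pos|lra]. }
  (* Stability gives only one factor [e] here; since [1 <= e], it may be enlarged to [e^2], which
     makes the bound a perfect square. *)
  assert (Hb : (U x - P x) ^ 2 + (V x - Q x) ^ 2 <= (Rabs (M - N) * e) ^ 2).
  { rewrite Rpow_mult_distr, pow2_abs.
    apply Rle_trans with (1 := H').
    replace (((M - N) ^ 2 + 0 ^ 2) * e) with ((M - N) ^ 2 * e) by ring.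
    apply Rmult_le_compat_l; [apply pow2_ge_0|nra]. }
  pose proof (pow2_ge_0 (U x - P x)). pose proof (pow2_ge_0 (V x - Q x)).
  split; rewrite <- (Rabs_pos_eq _ Hr); apply Rsqr_le_abs_0; unfold Rsqr; lra.
Qed.

(** The equation is autonomous, so the shifted orbit solves it too; stability with zero distance at
    [x0] then forces equality. *)
Lemma ode_eq_orbit (g : R -> R) (C M c d x0 : R) (u v U V : R -> R) :
  globally_lipschitz C g -> is_orbit g M U V -> c < x0 < d ->
  (forall x : R, c < x < d -> is_derive u x (v x)) ->
  (forall x : R, c < x < d -> is_derive v x (- g (u x))) ->
  u x0 = M -> v x0 = 0 ->
  forall x : R, c < x < d -> u x = U (x - x0).
Proof.
  intros Hg (HU0 & HV0 & HU & HV) Hx0 Hu Hv Hu0 Hv0 x Hx.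
  assert (Hs : forall (h k : R -> R), (forall t, is_derive h t (k t)) ->
     forall t, is_derive (fun t => h (t - x0)) t (k (t - x0))).
  { intros h k Hh t. unfold Rminus. specialize (Hh (t + - x0)).
    auto_derive.
    - now exists (k (t + - x0)).
    - rewrite (is_derive_unique (fun s : R => h s) _ _ Hh). ring. }
  assert (H := ode_stability g C c d x0 u v
     (fun t => U (t - x0)) (fun t => V (t - x0)) Hg Hx0 Hu Hv
     (fun t _ => Hs U V HU t) (fun t _ => Hs V (fun s => - g (U s)) HV t) x Hx).
  cbv beta in H. rewrite Rminus_diag, HU0, HV0, Hu0, Hv0, !Rminus_diag in H.
  rewrite pow_i, Rplus_0_l, Rmult_0_l in H by lia.
  pose proof (pow2_ge_0 (v x - V (x - x0))) as H1.
  pose proof (pow2_ge_0 (u x - U (x - x0))) as H2.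
  assert (H3 : (u x - U (x - x0)) ^ 2 = 0) by lra.
  assert (H4 : u x - U (x - x0) = 0); [|lra].
  rewrite <- Rsqr_pow2 in H3. now apply Rsqr_0_uniq.
Qed.

(** Time reversal: [U (- t)] with velocity [- V (- t)] solves the same initial value problem. *)
Lemma orbit_even (g : R -> R) (C M : R) (U V : R -> R) :
  globally_lipschitz C g -> is_orbit g M U V ->
  forall x : R, U (- x) = U x.
Proof.
  intros Hg HO x. pose proof HO as (HU0 & HV0 & HU & HV).
  pose proof (Rabs_pos x) as Hx.
  rewrite <- (Rminus_0_r x) at 2.
  apply (ode_eq_orbit g C M (- (Rabs x + 1)) (Rabs x + 1) 0
           (fun t => U (- t)) (fun t => - V (- t)) U V); trivial.
  - lra.
  - intros t _. specialize (HU (- t)). auto_derive.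
    + now exists (V (- t)).
    + rewrite (is_derive_unique (fun s : R => U s) _ _ HU). ring.
  - intros t _. specialize (HV (- t)). auto_derive.
    + now exists (- g (U (- t))).
    + rewrite (is_derive_unique (fun s : R => V s) _ _ HV). ring.
  - now rewrite Ropp_0.
  - rewrite Ropp_0, HV0. ring.
  - apply Rabs_lt_between. lra.
Qed.

Lemma orbit_starts_decreasing (g : R -> R) (M : R) (U V : R -> R) :
  is_orbit g M U V -> 0 < g M ->
  exists delta : R, 0 < delta /\ forall t : R, 0 < t < delta -> U t < M.
Proof.
  intros (HU0 & HV0 & HU & HV) HM.
  destruct (derive_pos_near (fun x => - V x) 0 (g M)) as [d [Hd1 Hd2]]; trivial.
  - rewrite <- (Ropp_involutive (g M)), <- HU0.
    apply (is_derive_opp (V := R_NormedModule)). apply HV.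
  - exists d. split; trivial. intros t Ht.
    destruct (mean_value U V 0 t) as [c [Hc1 Hc2]]; [lra|auto|].
    specialize (Hd2 c). rewrite HV0, Rminus_0_r, Rabs_pos_eq in Hd2 by lra.
    rewrite HU0 in Hc2.
    assert (0 < (- V c - - 0) * c) by (apply Hd2; lra).
    assert (V c < 0) by nra. nra.
Qed.

(* The minimum of [U] over [0, x] is a critical point of [U] at a level below
   [M]; energy conservation forbids critical levels in [0, M). *)
Lemma orbit_turning (g : R -> R) (C M : R) (U V : R -> R) (x : R) :
  globally_lipschitz C g -> is_orbit g M U V -> 0 < g M ->
  (forall r : R, 0 <= r < M -> potential g r < potential g M) ->
  0 < x -> 0 < V x -> exists z : R, 0 <= z <= x /\ U z < 0.
Proof.
  intros Hg HO HM Hpot Hx HVx. pose proof HO as (HU0 & HV0 & HU & HV).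
  destruct (continuity_ab_min U 0 x) as [z [Hz1 Hz2]]; [lra| |].
  { intros c _. now apply orbit_continuity_pt with g M V. }
  exists z. split; trivial.
  destruct (orbit_starts_decreasing g M U V HO HM) as [d [Hd1 Hd2]].
  assert (HzM : U z < M).
  { set (t := Rmin (d / 2) (x / 2)).
    assert (0 < t) by (apply Rmin_glb_lt; lra).
    assert (t <= d / 2) by apply Rmin_l.
    assert (t <= x / 2) by apply Rmin_r.
    apply Rle_lt_trans with (U t); [apply Hz1|apply Hd2]; lra. }
  assert (Hz0 : z <> 0) by (intros ->; lra).
  (* Since [0 < V x], the orbit is lower just before [x], so the minimum is not at this end. *)
  assert (Hzx : z <> x).
  { intros ->.
    destruct (derive_pos_near U x (V x)) as [e [He1 He2]]; trivial.
    set (t := Rmin (e / 2) (x / 2)).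
    assert (0 < t) by (apply Rmin_glb_lt; lra).
    assert (t <= e / 2) by apply Rmin_l.
    assert (t <= x / 2) by apply Rmin_r.
    specialize (He2 (x - t)). replace (x - t - x) with (- t) in He2 by ring.
    rewrite Rabs_Ropp, Rabs_pos_eq in He2 by lra.
    specialize (Hz1 (x - t)). nra. }
  assert (HVz : V z = 0).
  { apply (derive_zero_at_min U 0 x z); trivial; [lra|].
    intros y Hy. apply Hz1. lra. }
  assert (He := orbit_energy g C M U V Hg HO z). rewrite HVz in He.
  apply Rnot_le_lt. intros H0. specialize (Hpot (U z)). lra.
Qed.

(** An orbit staying positive can never turn upwards, by [orbit_turning], so after a short time it
    remains at or below a level smaller than [M]. There the energy leaves a kinetic part bounded
    away from 0, and descent at a uniform speed reaches zero in finite time. *)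
Lemma orbit_reaches_zero (g : R -> R) (C M : R) (U V : R -> R) :
  globally_lipschitz C g -> is_orbit g M U V -> 0 < g M ->
  (forall r : R, 0 <= r < M -> potential g r < potential g M) ->
  exists x : R, 0 < x /\ U x <= 0.
Proof.
  intros Hg HO HM Hpot. pose proof HO as (HU0 & HV0 & HU & HV).
  destruct (classic (exists x : R, 0 < x /\ U x <= 0)) as [H|Hno]; trivial.
  exfalso.
  assert (Hpos : forall x, 0 < x -> 0 < U x).
  { intros x Hx. apply Rnot_le_lt. intros Hle. apply Hno. now exists x. }
  assert (HVneg : forall x, 0 < x -> V x <= 0).
  { intros x Hx. apply Rnot_lt_le. intros HVx.
    destruct (orbit_turning g C M U V x Hg HO HM Hpot Hx HVx) as [z [Hz1 Hz2]].
    destruct (Req_dec z 0) as [->|Hne].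
    - rewrite HU0 in Hz2.
      destruct (orbit_starts_decreasing g M U V HO HM) as [d [Hd1 Hd2]].
      specialize (Hd2 (d / 2)). specialize (Hpos (d / 2)). lra.
    - specialize (Hpos z). lra. }
  destruct (orbit_starts_decreasing g M U V HO HM) as [d [Hd1 Hd2]].
  set (t := d / 2). assert (Ht : 0 < t) by (unfold t; lra).
  assert (HtM : U t < M) by (apply Hd2; unfold t; lra).
  assert (Hdecr : forall x, t <= x -> U x <= U t).
  { intros x Hx. destruct (Req_dec x t) as [->|Hne]; [lra|].
    destruct (mean_value U V t x) as [c [Hc1 Hc2]]; [lra|auto|].
    specialize (HVneg c). nra. }
  (* Compactness of [[0, U t]] turns the pointwise strict gap to [potential g M] into a uniform one,
     hence into a minimal speed [s]. *)
  destruct (continuity_ab_maj (potential g) 0 (U t)) as [r [Hr1 Hr2]].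
  { left. now apply Hpos. }
  { intros c _. apply is_derive_continuity_pt with (g c).
    now apply is_derive_potential with C. }
  assert (Hgap : potential g r < potential g M) by (apply Hpot; lra).
  set (s := sqrt (2 * (potential g M - potential g r))).
  assert (Hs : 0 < s) by (apply sqrt_lt_R0; lra).
  assert (Hs2 : s * s = 2 * (potential g M - potential g r)).
  { apply sqrt_sqrt. lra. }
  assert (HVs : forall x, t <= x -> V x <= - s).
  { intros x Hx. assert (He := orbit_energy g C M U V Hg HO x).
    specialize (Hr1 (U x)). specialize (Hpos x). specialize (Hdecr x Hx).
    specialize (HVneg x). nra. }
  (* By this time, descent at speed [s] has used up the whole height [U t]. *)
  set (x := t + U t / s).
  assert (HUts : 0 < U t / s) by (apply Rdiv_lt_0_compat; auto).
  destruct (mean_value U V t x) as [c [Hc1 Hc2]]; [unfold x; lra|auto|].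
  specialize (HVs c). specialize (Hpos x).
  assert (Hxs : s * (x - t) = U t) by (unfold x; field; lra).
  assert (Hx : 0 < x - t) by (unfold x; lra).
  assert (V c <= - s) by lra. unfold x in Hpos at 1. nra.
Qed.

Lemma orbit_equilibrium (g : R -> R) (C p : R) (U V : R -> R) :
  globally_lipschitz C g -> g p = 0 -> is_orbit g p U V ->
  forall x : R, U x = p.
Proof.
  intros Hg Hp HO x.
  assert (HP : is_orbit g p (fun _ => p) (fun _ => 0)).
  { split; [|split; [|split]]; trivial; intros t; rewrite ?Hp, ?Ropp_0;
      apply (is_derive_const (V := R_NormedModule)). }
  destruct (orbit_dependence g C p p U V _ _ x Hg HO HP) as [H _].
  rewrite Rminus_diag, Rabs_R0, Rmult_0_l in H.
  pose proof (Rabs_pos (U x - p)) as Hpos.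
  assert (H0 : U x - p = 0); [|lra].
  apply Rabs_eq_0. lra.
Qed.

(* The minimum of the orbit over [0, X] is Lipschitz in the starting level [M],
   hence vanishes for some [M]; as no orbit of positive energy can touch zero
   tangentially, the zero then sits at the endpoint [X]. *)
Lemma orbit_with_first_zero (g : R -> R) (C M1 pM X y : R) (U1 V1 : R -> R) :
  globally_lipschitz C g -> 0 < M1 <= pM -> g pM = 0 ->
  (forall M : R, M1 <= M <= pM -> 0 < potential g M) ->
  is_orbit g M1 U1 V1 -> 0 <= y <= X -> U1 y <= 0 ->
  exists (M : R) (U V : R -> R),
    is_orbit g M U V /\ U X = 0 /\ forall x : R, 0 <= x < X -> 0 < U x.
Proof.
  intros Hg HM1 HpM Hpot HO1 Hy HU1y.
  pose proof (globally_lipschitz_nonneg _ _ Hg) as HC.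
  destruct (choice (fun M m => exists (U V : R -> R) (z : R),
      is_orbit g M U V /\ 0 <= z <= X /\ U z = m /\
      forall x, 0 <= x <= X -> m <= U x)) as [m Hm].
  { intros M. destruct (orbit_exists g C M Hg) as [U [V HO]].
    destruct (continuity_ab_min U 0 X) as [z [Hz1 Hz2]]; [lra| |].
    - intros c _. now apply orbit_continuity_pt with g M V.
    - exists (U z), U, V, z. auto. }
  set (E := exp ((1 + C) * X)).
  assert (Hclose : forall M N U V P Q x, is_orbit g M U V -> is_orbit g N P Q ->
     0 <= x <= X -> P x - U x <= E * Rabs (M - N)).
  { intros M N U V P Q x HO HP Hx.
    destruct (orbit_dependence g C M N U V P Q x Hg HO HP) as [H _].
    rewrite (Rabs_pos_eq x) in H by lra.
    assert (exp ((1 + C) * x) <= E).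
    { unfold E. destruct (Req_dec x X) as [->|Hne]; [lra|].
      left. apply exp_increasing. nra. }
    pose proof (Rcomplements.Rabs_maj2 (U x - P x)).
    pose proof (Rabs_pos (M - N)). nra. }
  (* Evaluate the orbit from [N] at the minimum point of the orbit from [M]; exchanging the two
     gives the Lipschitz bound. *)
  assert (Hhalf : forall M N, m N - m M <= E * Rabs (M - N)).
  { intros M N.
    destruct (Hm M) as (U & V & z & HO & Hz & HUz & _).
    destruct (Hm N) as (P & Q & w & HP & _ & _ & Hmin).
    specialize (Hclose M N U V P Q z HO HP Hz). specialize (Hmin z Hz). lra. }
  assert (Hlip : globally_lipschitz E m).
  { intros p q. pose proof (Hhalf p q) as H1. pose proof (Hhalf q p) as H2.
    rewrite Rabs_minus_sym in H2. apply Rabs_le. lra. }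
  destruct (IVT_cor m M1 pM) as [M [HM HmM]].
  { intros x. apply continuity_pt_filterlim.
    now apply globally_lipschitz_continuous with E. }
  { lra. }
  { destruct (Hm M1) as (U & V & z & HO & _ & _ & Hmin).
    destruct (Hm pM) as (P & Q & w & HP & _ & Hw & _).
    rewrite (orbit_equilibrium g C pM P Q) in Hw by trivial.
    specialize (Hmin y Hy).
    (* With equal starting levels, dependence is uniqueness: the orbit chosen for [M1] agrees with
       [U1], so [m M1 <= 0], while the equilibrium gives [m pM = pM > 0]. *)
    destruct (orbit_dependence g C M1 M1 U V U1 V1 y Hg HO HO1) as [H _].
    rewrite Rminus_diag, Rabs_R0, Rmult_0_l in H.
    pose proof (Rle_abs (U y - U1 y)). nra. }
  destruct (Hm M) as (U & V & z & HO & Hz & HUz & Hmin).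
  rewrite HmM in *. pose proof HO as (HU0 & _ & HU & _).
  assert (Hint : forall x, 0 <= x < X -> U x <> 0).
  { intros x Hx H0.
    assert (x <> 0) by (intros ->; lra).
    assert (HVx : V x = 0).
    { apply (derive_zero_at_min U 0 X x); trivial; [lra|].
      intros t Ht. rewrite H0. apply Hmin. lra. }
    assert (He := orbit_energy g C M U V Hg HO x).
    rewrite HVx, H0, potential_0 in He. specialize (Hpot M HM). lra. }
  exists M, U, V. split; [trivial|split].
  - destruct (Req_dec z X) as [<-|Hne]; trivial.
    exfalso. apply (Hint z); [lra|trivial].
  - intros x Hx. specialize (Hint x Hx). specialize (Hmin x). lra.
Qed.

(** * Dirichlet solutions as shifted orbits *)

Definition nonneg_ext (f : R -> R) (p : R) : R := f (Rmax 0 p).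

Lemma nonneg_ext_eq (f : R -> R) (p : R) : 0 <= p -> nonneg_ext f p = f p.
Proof. intros Hp. unfold nonneg_ext. now rewrite Rmax_right. Qed.

Lemma nonneg_ext_lipschitz (f : R -> R) :
  lipschitz_on_nonneg f -> exists C : R, globally_lipschitz C (nonneg_ext f).
Proof.
  intros [C HC]. exists C. intros p q. unfold nonneg_ext.
  assert (H0 : 0 <= C).
  { specialize (HC 1 0). rewrite Rminus_0_r, Rabs_R1 in HC.
    pose proof (Rabs_pos (f 1 - f 0)). lra. }
  apply Rle_trans with (1 := HC _ _ (Rmax_l 0 p) (Rmax_l 0 q)).
  apply Rmult_le_compat_l; trivial.
  unfold Rmax. destruct (Rle_dec 0 p), (Rle_dec 0 q); unfold Rabs;
    repeat destruct Rcase_abs; lra.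
Qed.

(** Evenness copies the zero at [L / 2] and the positivity before it to the left half; where the
    profile is positive, [nonneg_ext f] is [f]. *)
Lemma shifted_orbit_is_solution (f : R -> R) (C M L : R) (U V : R -> R) :
  globally_lipschitz C (nonneg_ext f) -> 0 < L ->
  is_orbit (nonneg_ext f) M U V -> U (L / 2) = 0 ->
  (forall x : R, 0 <= x < L / 2 -> 0 < U x) ->
  is_solution f L (fun x => U (x - L / 2)) /\
  positivity_set_is_interior L (fun x => U (x - L / 2)).
Proof.
  intros Hg HL HO HUX Hpos. pose proof HO as (_ & _ & HU & HV).
  assert (Heven := orbit_even _ C M U V Hg HO).
  set (u := fun x => U (x - L / 2)).
  assert (Hu : forall x, is_derive u x (V (x - L / 2))).
  { intros x. unfold u, Rminus. specialize (HU (x + - (L / 2))). auto_derive.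
    - now exists (V (x + - (L / 2))).
    - rewrite (is_derive_unique (fun s : R => U s) _ _ HU). ring. }
  assert (HDu : forall x, Derive u x = V (x - L / 2)).
  { intros x. now apply is_derive_unique. }
  assert (HDDu : forall x, is_derive (Derive u) x (- nonneg_ext f (u x))).
  { intros x. apply is_derive_ext with (fun x => V (x - L / 2)).
    - intros t. now rewrite HDu.
    - unfold u, Rminus. specialize (HV (x + - (L / 2))). auto_derive.
      + now exists (- nonneg_ext f (U (x + - (L / 2)))).
      + rewrite (is_derive_unique (fun s : R => V s) _ _ HV). ring. }
  assert (Hupos : forall x, 0 < x < L -> 0 < u x).
  { intros x Hx. unfold u. destruct (Rle_dec (L / 2) x).
    - apply Hpos. lra.
    - rewrite <- Heven. apply Hpos. lra. }
  assert (Hu0 : u 0 = 0).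
  { unfold u. replace (0 - L / 2) with (- (L / 2)) by ring. now rewrite Heven. }
  assert (HuL : u L = 0).
  { unfold u. replace (L - L / 2) with (L / 2) by field. trivial. }
  split; [split; [|split; [|split; [|split]]]|].
  - intros x _. eapply filterlim_filter_le_1.
    + apply filter_le_within.
    + apply (ex_derive_continuous (V := R_NormedModule)). eexists. apply Hu.
  - intros x _. split; eexists; [apply Hu|apply HDDu].
  - intros x Hx.
    change (Derive_n u 2 x) with (Derive (Derive u) x).
    rewrite (is_derive_unique _ _ _ (HDDu x)), Ropp_involutive.
    apply nonneg_ext_eq. left. auto.
  - intros x Hx. left. auto.
  - auto.
  - intros x Hx. split; [|auto]. intros Hux.
    split.
    + destruct (Req_dec x 0) as [->|]; lra.
    + destruct (Req_dec x L) as [->|]; lra.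
Qed.

(** The retraction onto [[0, L]]: composing with it turns continuity relative to [[0, L]] into
    continuity on the whole line, as the extreme value theorem is applied to total functions. *)
Definition clamp (L x : R) : R := Rmax 0 (Rmin L x).

Lemma clamp_id (L x : R) : 0 <= x <= L -> clamp L x = x.
Proof.
  intros Hx. unfold clamp. rewrite Rmin_right by lra. apply Rmax_right. lra.
Qed.

Lemma continuous_on_clamp (L : R) (u : R -> R) :
  0 <= L -> continuous_on (fun x : R => 0 <= x <= L) u ->
  forall x : R, continuous (fun t => u (clamp L t)) x.
Proof.
  intros HL Hu x.
  assert (Hrange : forall t, 0 <= clamp L t <= L).
  { intros t. unfold clamp, Rmax, Rmin.
    destruct (Rle_dec L t); destruct Rle_dec; lra. }
  apply filterlim_comp
    with (G := within (fun x : R => 0 <= x <= L) (locally (clamp L x))).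
  - intros P [eps HP]. exists eps. intros y Hy. apply HP; [|apply Hrange].
    change (Rabs (y - x) < eps) in Hy.
    change (Rabs (clamp L y - clamp L x) < eps).
    apply Rle_lt_trans with (2 := Hy).
    unfold clamp, Rmax, Rmin.
    destruct (Rle_dec L y), (Rle_dec L x); repeat destruct Rle_dec;
      unfold Rabs; repeat destruct Rcase_abs; lra.
  - apply Hu. apply Hrange.
Qed.

Lemma continuity_pt_zero (h : R -> R) (a : R) :
  continuity_pt h a ->
  (forall delta : R, 0 < delta ->
     exists t : R, t <> a /\ Rabs (t - a) < delta /\ h t = 0) ->
  h a = 0.
Proof.
  intros Hc Hz. apply cond_eq. intros eps Heps.
  destruct (Hc eps Heps) as [d [Hd1 Hd2]].
  destruct (Hz d Hd1) as [t [Hne [Ht H0]]].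
  specialize (Hd2 t). unfold dist in Hd2; simpl in Hd2; unfold Rdist in Hd2.
  assert (H : Rabs (h t - h a) < eps).
  { apply Hd2. repeat split; auto. }
  now rewrite H0, Rabs_minus_sym in H.
Qed.

Lemma zero_on_closure (h : R -> R) (L : R) :
  0 < L -> (forall x : R, continuity_pt h x) ->
  (forall x : R, 0 < x < L -> h x = 0) ->
  forall x : R, 0 <= x <= L -> h x = 0.
Proof.
  intros HL Hc Hz x Hx. apply continuity_pt_zero; [apply Hc|].
  intros d Hd.
  set (t := Rmin (d / 2) (L / 3)).
  assert (0 < t) by (apply Rmin_glb_lt; lra).
  assert (t <= d / 2) by apply Rmin_l.
  assert (t <= L / 3) by apply Rmin_r.
  destruct (Rle_dec x (L / 2)).
  - exists (x + t). replace (x + t - x) with t by ring.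
    rewrite Rabs_pos_eq by lra. repeat split; try lra. apply Hz. lra.
  - exists (x - t). replace (x - t - x) with (- t) by ring.
    rewrite Rabs_Ropp, Rabs_pos_eq by lra. repeat split; try lra. apply Hz. lra.
Qed.

Lemma solution_derive (f : R -> R) (L : R) (u : R -> R) :
  is_solution f L u ->
  forall x : R, 0 < x < L ->
    is_derive u x (Derive u x) /\
    is_derive (Derive u) x (- nonneg_ext f (u x)).
Proof.
  intros (_ & Hd & Heq & Hpos & _) x Hx. destruct (Hd x Hx) as [H1 H2].
  specialize (Heq x Hx). specialize (Hpos x Hx).
  rewrite nonneg_ext_eq by trivial. rewrite <- Heq, Ropp_involutive.
  split; now apply Derive_correct.
Qed.

(** Uniqueness identifies [u] with the orbit inside [(0, L)], and continuity extends this to the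
    endpoints, where the energy is later evaluated. The sign [0 <= f M] is the second derivative
    test at the maximum; it later keeps [M] from exceeding [pM]. *)
Lemma solution_is_shifted_orbit (f : R -> R) (C L : R) (u : R -> R) :
  globally_lipschitz C (nonneg_ext f) -> 0 < L ->
  is_solution f L u -> nontrivial L u ->
  exists (M x0 : R) (U V : R -> R),
    0 < M /\ 0 <= f M /\ 0 < x0 < L /\ is_orbit (nonneg_ext f) M U V /\
    forall x : R, 0 <= x <= L -> u x = U (x - x0).
Proof.
  intros Hg HL Hsol [x1 [Hx1 Hne]].
  assert (Hder := solution_derive f L u Hsol).
  destruct Hsol as (Hc & _ & _ & Hpos & Hu0 & HuL).
  assert (Hcl := continuous_on_clamp L u (Rlt_le _ _ HL) Hc).
  destruct (continuity_ab_maj (fun t => u (clamp L t)) 0 L) as [x0 [Hmax Hx0]].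
  { lra. }
  { intros c _. apply continuity_pt_filterlim. apply Hcl. }
  assert (Hmax' : forall x, 0 <= x <= L -> u x <= u x0).
  { intros x Hx. specialize (Hmax x Hx). now rewrite !clamp_id in Hmax. }
  assert (HM : 0 < u x0).
  { apply Rlt_le_trans with (u x1); [|auto].
    assert (0 < x1 < L).
    { split; [destruct (Req_dec x1 0) as [->|]; lra|].
      destruct (Req_dec x1 L) as [->|]; lra. }
    specialize (Hpos x1). lra. }
  assert (Hx0' : 0 < x0 < L).
  { split; [destruct (Req_dec x0 0) as [->|]; lra|].
    destruct (Req_dec x0 L) as [->|]; lra. }
  destruct (second_derive_at_max u (Derive u) 0 L x0
              (- nonneg_ext f (u x0))) as [HD0 HDD0]; trivial.
  { intros x Hx. apply Hder. trivial. }
  { apply Hder. trivial. }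
  { intros x Hx. apply Hmax'. lra. }
  destruct (orbit_exists (nonneg_ext f) C (u x0) Hg) as [U [V HO]].
  exists (u x0), x0, U, V.
  split; [|split; [|split; [|split]]]; trivial.
  - rewrite nonneg_ext_eq in HDD0 by lra. lra.
  - assert (Hin : forall x, 0 < x < L -> u x = U (x - x0)).
    { apply (ode_eq_orbit (nonneg_ext f) C (u x0) 0 L x0 u (Derive u) U V);
        trivial; intros x Hx; apply Hder; trivial. }
    intros x Hx.
    assert (H0 : u (clamp L x) - U (x - x0) = 0).
    { apply (zero_on_closure (fun x => u (clamp L x) - U (x - x0)) L); trivial.
      - intros t. apply continuity_pt_minus.
        + apply continuity_pt_filterlim. apply Hcl.
        + apply (continuity_pt_comp (fun s => s - x0) U).
          * apply continuity_pt_minus.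
            -- apply continuity_pt_id.
            -- apply continuity_pt_const. intros a b. reflexivity.
          * now apply orbit_continuity_pt with (nonneg_ext f) (u x0) V.
      - intros t Ht. rewrite clamp_id by lra. rewrite (Hin t Ht). ring. }
    rewrite clamp_id in H0 by trivial. lra.
Qed.

(* Sturm-type comparison with [cos (k (x - L/2))], [sqrt K < k < PI / L], which
   is positive on [0, L]: look at the maximum of the quotient. *)
Lemma positive_solution_length (f : R -> R) (K L : R) (u : R -> R) :
  0 < K -> (forall p : R, 0 < p -> f p <= K * p) -> 0 < L ->
  is_solution f L u -> positivity_set_is_interior L u ->
  PI / sqrt K <= L.
Proof.
  intros HK HfK HL Hsol Hposi.
  apply Rnot_lt_le. intros HLt.
  assert (Hder := solution_derive f L u Hsol).
  destruct Hsol as (Hc & _ & _ & _ & Hu0 & HuL).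
  assert (Hpos : forall x, 0 < x < L -> 0 < u x).
  { intros x Hx. apply Hposi; lra. }
  assert (HsK : 0 < sqrt K) by (now apply sqrt_lt_R0).
  assert (HsK2 : sqrt K * sqrt K = K) by (apply sqrt_sqrt; lra).
  pose proof PI_RGT_0 as HPI.
  set (k := (sqrt K + PI / L) / 2).
  assert (HKL : sqrt K < PI / L).
  { apply Rmult_lt_reg_r with (L / sqrt K).
    - apply Rdiv_lt_0_compat; lra.
    - replace (sqrt K * (L / sqrt K)) with L by (field; lra).
      replace (PI / L * (L / sqrt K)) with (PI / sqrt K) by (field; lra).
      trivial. }
  assert (Hk1 : sqrt K < k) by (unfold k; lra).
  assert (Hk2 : k * L < PI).
  { apply Rlt_le_trans with (PI / L * L).
    - apply Rmult_lt_compat_r; unfold k; lra.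
    - right. field. lra. }
  set (s := fun x => cos (k * (x - L / 2))).
  assert (Hs : forall x, 0 <= x <= L -> 0 < s x).
  { intros x Hx. unfold s. apply cos_gt_0; nra. }
  assert (Hsd : forall x, is_derive s x (- (k * sin (k * (x - L / 2))))).
  { intros x. unfold s. auto_derive; trivial. unfold Rminus. ring. }
  destruct (continuity_ab_maj (fun t => u (clamp L t) / s t) 0 L)
    as [x0 [Hmax Hx0]].
  { lra. }
  { intros c Hc'. apply continuity_pt_div.
    - apply continuity_pt_filterlim. apply continuous_on_clamp; trivial. lra.
    - eapply is_derive_continuity_pt. apply Hsd.
    - specialize (Hs c Hc'). lra. }
  rewrite (clamp_id L x0) in Hmax by trivial.
  set (m := u x0 / s x0) in Hmax.
  assert (Hsx0 := Hs x0 Hx0).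
  assert (Hmax' : forall x, 0 <= x <= L -> u x <= m * s x).
  { intros x Hx. specialize (Hmax x Hx). rewrite clamp_id in Hmax by trivial.
    specialize (Hs x Hx).
    apply Rmult_le_compat_r with (r := s x) in Hmax; [|lra].
    replace (u x / s x * s x) with (u x) in Hmax by (field; lra). trivial. }
  assert (Hm : m * s x0 = u x0) by (unfold m; field; lra).
  assert (Hmpos : 0 < m).
  { specialize (Hmax' (L / 2)). specialize (Hpos (L / 2)).
    specialize (Hs (L / 2)).
    apply Rnot_le_lt. intros H. assert (u (L / 2) <= m * s (L / 2)) by lra.
    assert (m * s (L / 2) <= 0) by nra. lra. }
  assert (Hux0 : 0 < u x0) by nra.
  assert (Hx0' : 0 < x0 < L).
  { split; [destruct (Req_dec x0 0) as [->|]; lra|].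
    destruct (Req_dec x0 L) as [->|]; lra. }
  (* The difference [u - m s] is nonpositive and vanishes at [x0], so the second derivative test
     yields [k^2 u(x0) <= f (u x0) <= K u(x0)], contradicting [K < k^2]. *)
  destruct (second_derive_at_max (fun x => u x - m * s x)
     (fun x => Derive u x + m * k * sin (k * (x - L / 2))) 0 L x0
     (- nonneg_ext f (u x0) + m * k * (k * s x0))) as [_ H]; trivial.
  - intros x Hx. destruct (Hder x Hx) as [H1 _].
    replace (Derive u x + m * k * sin (k * (x - L / 2)))
      with (minus (Derive u x) (m * - (k * sin (k * (x - L / 2)))))
      by (unfold minus, plus, opp; simpl; ring).
    apply (is_derive_minus (V := R_NormedModule)); trivial.
    apply is_derive_scal. apply Hsd.
  - destruct (Hder x0 Hx0') as [_ H2].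
    apply (is_derive_plus (V := R_NormedModule)); trivial.
    unfold s. auto_derive; trivial. unfold Rminus. ring.
  - intros x Hx. specialize (Hmax' x). rewrite Hm. lra.
  - rewrite nonneg_ext_eq in H by lra. specialize (HfK (u x0) Hux0).
    replace (m * k * (k * s x0)) with (k * k * u x0) in H by (rewrite <- Hm; ring).
    assert (K < k * k) by nra. nra.
Qed.

(** * The two sign patterns *)

(* Bistable is [a = alpha], monostable is [a = 0]. *)
Definition sign_pattern (f : R -> R) (a pM : R) : Prop :=
  0 <= a < pM /\
  (forall p : R, 0 <= p < a -> f p < 0) /\
  (forall p : R, a < p < pM -> 0 < f p) /\
  (forall p : R, pM < p -> f p < 0) /\
  f 0 <= 0.

Lemma sign_pattern_exists (f : R -> R) (pM : R) :
  0 < pM -> bistable f pM \/ monostable f pM ->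
  exists a : R, sign_pattern f a pM.
Proof.
  intros HpM [[a (Ha & Hp & Hn)]|(H0 & Hp & Hn)].
  - exists a. repeat split; auto; try lra. left. apply Hn. lra.
  - exists 0. repeat split; auto; try lra. intros p Hp'. lra.
Qed.

(** The value at [pM] is squeezed by the Lipschitz bound between [f (pM + d) < 0] and
    [f (pM - d) > 0] for small [d]. *)
Lemma sign_pattern_zero (f : R -> R) (C a pM : R) :
  globally_lipschitz C (nonneg_ext f) -> sign_pattern f a pM ->
  nonneg_ext f pM = 0.
Proof.
  intros Hg (Ha & _ & Hp & Hn & _).
  pose proof (globally_lipschitz_nonneg _ _ Hg) as HC.
  apply cond_eq. intros eps Heps. rewrite Rminus_0_r.
  set (d := Rmin (eps / (C + 1)) ((pM - a) / 2)).
  assert (Hd0 : 0 < d).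
  { apply Rmin_glb_lt; [apply Rdiv_lt_0_compat|]; lra. }
  assert (Hd1 : d <= (pM - a) / 2) by apply Rmin_r.
  assert (Hd2 : C * d < eps).
  { assert (H : d <= eps / (C + 1)) by apply Rmin_l.
    apply Rmult_le_compat_l with (r := C + 1) in H; [|lra].
    replace ((C + 1) * (eps / (C + 1))) with eps in H by (field; lra). lra. }
  assert (H1 := Hg pM (pM + d)). assert (H2 := Hg pM (pM - d)).
  replace (pM - (pM + d)) with (- d) in H1 by ring.
  replace (pM - (pM - d)) with d in H2 by ring.
  rewrite Rabs_Ropp, (Rabs_pos_eq d) in H1 by lra.
  rewrite (Rabs_pos_eq d) in H2 by lra.
  rewrite (nonneg_ext_eq f (pM + d)) in H1 by lra.
  rewrite (nonneg_ext_eq f (pM - d)) in H2 by lra.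
  specialize (Hp (pM - d)). specialize (Hn (pM + d)).
  apply Rcomplements.Rabs_le_between in H1, H2.
  apply Rabs_lt_between. lra.
Qed.

Lemma potential_nonneg_ext (f : R -> R) (pM : R) :
  0 <= pM -> RInt f 0 pM = potential (nonneg_ext f) pM.
Proof.
  intros HpM. apply RInt_ext. intros x.
  rewrite Rmin_left, Rmax_right by lra. intros Hx.
  symmetry. apply nonneg_ext_eq. lra.
Qed.

Section SignPattern.

Context (f : R -> R) (C a pM : R).
Context (Hg : globally_lipschitz C (nonneg_ext f)).
Context (Hf : sign_pattern f a pM).

Let g := nonneg_ext f.
Let F := potential g.

Lemma nonneg_ext_pos (p : R) : a < p < pM -> 0 < g p.
Proof.
  intros Hp. destruct Hf as (Ha & _ & H & _).
  unfold g. rewrite nonneg_ext_eq by lra. auto.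
Qed.

Lemma potential_neg_left (p : R) : 0 < p <= a -> F p < 0.
Proof.
  intros Hp. destruct Hf as (_ & H & _).
  unfold F. rewrite <- (potential_0 g).
  apply potential_decreasing with C; trivial; [lra|].
  intros x Hx. unfold g. rewrite nonneg_ext_eq by lra. apply H. lra.
Qed.

Lemma potential_incr_right (p q : R) : a <= p < q -> q <= pM -> F p < F q.
Proof.
  intros Hpq Hq. apply potential_increasing with C; trivial; [lra|].
  intros x Hx. apply nonneg_ext_pos. lra.
Qed.

Lemma potential_neg_everywhere (p : R) : F pM < 0 -> 0 < p <= pM -> F p < 0.
Proof.
  intros HF Hp. destruct (Rle_dec p a).
  - apply potential_neg_left. lra.
  - destruct (Req_dec p pM) as [->|Hne]; trivial.
    assert (F p < F pM) by (apply potential_incr_right; lra). lra.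
Qed.

Lemma potential_nonneg_gt (M : R) : 0 < M -> 0 <= F M -> a < M.
Proof.
  intros HM HFM. apply Rnot_le_lt. intros Hle.
  assert (F M < 0) by (apply potential_neg_left; lra). lra.
Qed.

(** [F] starts at 0, is negative on [(0, a]] and increases on [[a, pM]], so a positive value exceeds
    all earlier ones. This is the hypothesis of [orbit_turning] and [orbit_reaches_zero]. *)
Lemma potential_pos_dominates (M r : R) :
  0 < M <= pM -> 0 < F M -> 0 <= r < M -> F r < F M.
Proof.
  intros HM HFM Hr.
  assert (a < M) by (apply potential_nonneg_gt; lra).
  destruct (Rle_dec r a) as [Hra|Hra]; [|apply potential_incr_right; lra].
  destruct (Req_dec r 0) as [->|Hne].
  - unfold F at 1. now rewrite potential_0.
  - assert (F r < 0) by (apply potential_neg_left; lra). lra.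
Qed.

(** * Lengths within which an orbit of positive energy reaches zero *)

Definition reaching_length (L : R) : Prop :=
  exists (M y : R) (U V : R -> R),
    0 < M < pM /\ 0 < F M /\ is_orbit g M U V /\ 0 <= y <= L / 2 /\ U y <= 0.

Lemma reaching_length_mono (L L' : R) :
  reaching_length L -> L <= L' -> reaching_length L'.
Proof.
  intros (M & y & U & V & HM & HFM & HO & Hy & HUy) HL.
  exists M, y, U, V. repeat (split; [assumption|]). split; [lra|trivial].
Qed.

(** The level [pM] is an equilibrium and never descends; by continuity [F] is still positive at a
    level slightly below it, whose orbit does reach zero. *)
Lemma reaching_length_exists :
  0 < F pM -> exists L : R, 0 < L /\ reaching_length L.
Proof.
  intros HF. pose proof Hf as (Ha & _).
  assert (HM : exists M, a < M < pM /\ 0 < F M).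
  { assert (Hc : continuity_pt F pM).
    { apply is_derive_continuity_pt with (g pM).
      now apply is_derive_potential with C. }
    destruct (Hc (F pM) HF) as [d [Hd1 Hd2]].
    set (t := Rmin (d / 2) ((pM - a) / 2)).
    assert (0 < t) by (apply Rmin_glb_lt; lra).
    assert (t <= d / 2) by apply Rmin_l.
    assert (t <= (pM - a) / 2) by apply Rmin_r.
    exists (pM - t). split; [lra|].
    specialize (Hd2 (pM - t)). unfold dist in Hd2; simpl in Hd2.
    unfold Rdist in Hd2. replace (pM - t - pM) with (- t) in Hd2 by ring.
    rewrite Rabs_Ropp, (Rabs_pos_eq t) in Hd2 by lra.
    assert (H' : Rabs (F (pM - t) - F pM) < F pM).
    { apply Hd2. repeat split; lra. }
    apply Rabs_lt_between in H'. lra. }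
  destruct HM as [M [HM HFM]].
  destruct (orbit_exists g C M Hg) as [U [V HO]].
  destruct (orbit_reaches_zero g C M U V) as [x [Hx HUx]]; trivial.
  - now apply nonneg_ext_pos.
  - intros r Hr. apply potential_pos_dominates; lra.
  - exists (2 * x). split; [lra|]. exists M, x, U, V.
    split; [lra|]. repeat (split; [assumption|]). split; [lra|trivial].
Qed.

(** Positive energy forces [a < M1], and [F] increases on [[a, pM]]; hence the energy stays positive
    while the level is raised from [M1] to [pM]. *)
Lemma reaching_length_solution (L : R) :
  0 < L -> reaching_length L ->
  exists u : R -> R, is_solution f L u /\ positivity_set_is_interior L u.
Proof.
  intros HL (M1 & y & U1 & V1 & HM1 & HFM1 & HO1 & Hy & HU1y).
  destruct (orbit_with_first_zero g C M1 pM (L / 2) y U1 V1)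
    as (M & U & V & HO & HU0 & Hpos); trivial.
  - lra.
  - now apply sign_pattern_zero with C a.
  - intros M HM. destruct (Req_dec M M1) as [->|Hne]; trivial.
    assert (F M1 < F M); [|fold F; lra].
    assert (a < M1) by (apply potential_nonneg_gt; lra).
    apply potential_incr_right; lra.
  - exists (fun x => U (x - L / 2)).
    now apply shifted_orbit_is_solution with C M V.
Qed.

(* In the zero-energy case the orbit touches zero with vertical acceleration
   [- f 0 > 0], so it moves upwards right afterwards; nearby orbits of positive
   energy then move upwards too, which forces them below zero before. *)
Lemma solution_reaching_length (L L' : R) (u : R -> R) :
  0 < F pM -> 0 < L -> is_solution f L u -> nontrivial L u -> L < L' ->
  reaching_length L'.
Proof.
  intros HF HL Hsol Hnt HLL'.
  pose proof (globally_lipschitz_nonneg _ _ Hg) as HC.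
  pose proof Hf as (Ha & Hn & _ & Hnn & _).
  destruct (solution_is_shifted_orbit f C L u Hg HL Hsol Hnt)
    as (M & x0 & U & V & HM & HfM & Hx0 & HO & Hux).
  destruct Hsol as (_ & _ & _ & _ & Hu0 & HuL).
  fold g in HO.
  assert (HU1 : U x0 = 0).
  { rewrite <- (orbit_even g C M U V Hg HO).
    replace (- x0) with (0 - x0) by ring. rewrite <- Hux by lra. trivial. }
  assert (HU2 : U (L - x0) = 0) by (rewrite <- Hux by lra; trivial).
  assert (HMpM : M < pM).
  { destruct (Rtotal_order M pM) as [H|[H|H]]; trivial; exfalso.
    - subst M.
      rewrite (orbit_equilibrium g C pM U V Hg) in HU1; trivial; [lra|].
      now apply sign_pattern_zero with C a.
    - specialize (Hnn M). lra. }
  (* By evenness both endpoints give zeros at positive times, [x0] and [L - x0]; the smaller is at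
     most [L / 2]. *)
  assert (Hy : exists y, 0 < y <= L / 2 /\ U y = 0).
  { destruct (Rle_dec x0 (L / 2)); [exists x0|exists (L - x0)];
      (split; [lra|trivial]). }
  destruct Hy as [y [Hy HUy]].
  assert (He := orbit_energy g C M U V Hg HO y).
  rewrite HUy, potential_0 in He. fold F in He.
  assert (HVy2 := pow2_ge_0 (V y)).
  assert (HaM : a < M) by (apply potential_nonneg_gt; lra).
  destruct (Rle_lt_dec (F M) 0) as [HFM|HFM].
  - assert (HVy : V y = 0).
    { apply Rsqr_0_uniq. rewrite Rsqr_pow2. lra. }
    (* Zero energy is a bistable phenomenon: with [a = 0] the potential would increase from
       [F 0 = 0]. Hence [f 0 < 0]. *)
    assert (Ha0 : 0 < a).
    { destruct (Req_dec a 0) as [Ha0|]; [|lra]. exfalso.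
      assert (F 0 < F M) by (apply potential_incr_right; lra).
      unfold F at 1 in H. rewrite potential_0 in H. lra. }
    pose proof HO as (_ & _ & _ & HV).
    destruct (derive_pos_near V y (- g (U y)) (HV y)) as [d [Hd1 Hd2]].
    { rewrite HUy. unfold g. rewrite nonneg_ext_eq by lra.
      specialize (Hn 0). lra. }
    (* The second bound keeps [y + e] within [L' / 2]; this is where the strict inequality [L < L']
       is spent. *)
    set (e := Rmin (d / 2) ((L' - L) / 2)).
    assert (0 < e) by (apply Rmin_glb_lt; lra).
    assert (e <= d / 2) by apply Rmin_l.
    assert (e <= (L' - L) / 2) by apply Rmin_r.
    set (t := y + e).
    assert (HVt : 0 < V t).
    { specialize (Hd2 t). unfold t in Hd2 at 1 2 4.
      replace (y + e - y) with e in Hd2 by ring.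
      rewrite Rabs_pos_eq, HVy in Hd2 by lra.
      assert (0 < (V t - 0) * e) by (apply Hd2; lra). nra. }
    set (E := exp ((1 + C) * Rabs t)).
    assert (HE : 0 < E) by apply exp_pos.
    assert (HVE : 0 < V t / (2 * E)) by (apply Rdiv_lt_0_compat; lra).
    (* Small enough that [M + h < pM] and that the velocity at [t] changes by at most [V t / 2],
       hence stays positive. *)
    set (h := Rmin ((pM - M) / 2) (V t / (2 * E))).
    assert (0 < h) by (apply Rmin_glb_lt; lra).
    assert (h <= (pM - M) / 2) by apply Rmin_l.
    assert (HhE : h * E <= V t / 2).
    { apply Rle_trans with (V t / (2 * E) * E).
      - apply Rmult_le_compat_r; [lra|apply Rmin_r].
      - right. field. lra. }
    destruct (orbit_exists g C (M + h) Hg) as [P [Q HP]].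
    destruct (orbit_dependence g C M (M + h) U V P Q t Hg HO HP) as [_ Hdep].
    fold E in Hdep. replace (M - (M + h)) with (- h) in Hdep by ring.
    rewrite Rabs_Ropp, (Rabs_pos_eq h) in Hdep by lra.
    assert (HQt : 0 < Q t).
    { pose proof (Rle_abs (V t - Q t)). lra. }
    assert (HFh : 0 < F (M + h)).
    { assert (F M < F (M + h)) by (apply potential_incr_right; lra). lra. }
    destruct (orbit_turning g C (M + h) P Q t) as [z [Hz HPz]]; trivial.
    { apply nonneg_ext_pos. lra. }
    { intros r Hr. apply potential_pos_dominates; lra. }
    { unfold t. lra. }
    exists (M + h), z, P, Q.
    split; [lra|]. repeat (split; [assumption|]). unfold t in Hz.
    split; [lra|]. lra.
  - exists M, y, U, V.
    split; [lra|]. repeat (split; [assumption|]). split; lra.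
Qed.

(** The zero function has to be excluded as well: [F pM < 0] forces [0 < a], since otherwise [F]
    would increase from 0, and then [f 0 < 0] is incompatible with [u = 0]. *)
Lemma no_solution_negative_mass (L : R) (u : R -> R) :
  F pM < 0 -> 0 < L -> ~ is_solution f L u.
Proof.
  intros HF HL Hsol. pose proof Hf as (Ha & Hn & _ & Hnn & _).
  assert (Ha0 : 0 < a).
  { destruct (Req_dec a 0) as [Ha0|]; [|lra]. exfalso.
    assert (H : F 0 < F pM) by (apply potential_incr_right; lra).
    unfold F at 1 in H. rewrite potential_0 in H. lra. }
  destruct (classic (nontrivial L u)) as [Hnt|Htriv].
  - destruct (solution_is_shifted_orbit f C L u Hg HL Hsol Hnt)
      as (M & x0 & U & V & HM & HfM & Hx0 & HO & Hux).
    destruct Hsol as (_ & _ & _ & _ & Hu0 & _).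
    assert (He := orbit_energy g C M U V Hg HO (0 - x0)).
    rewrite <- Hux, Hu0, potential_0 in He by lra.
    assert (HVy2 := pow2_ge_0 (V (0 - x0))).
    assert (M <= pM).
    { apply Rnot_lt_le. intros H. specialize (Hnn M H). lra. }
    assert (F M < 0) by (apply potential_neg_everywhere; lra).
    fold F in He. lra.
  - assert (Hz : forall x, 0 < x < L -> u x = 0).
    { intros x Hx. destruct (Req_dec (u x) 0) as [|Hne]; trivial.
      exfalso. apply Htriv. exists x. split; [lra|trivial]. }
    assert (Hder := solution_derive f L u Hsol).
    destruct (second_derive_at_max u (Derive u) 0 L (L / 2)
                (- nonneg_ext f (u (L / 2)))) as [_ H].
    + lra.
    + intros x Hx. now apply Hder.
    + apply Hder. lra.
    + intros x Hx. rewrite !Hz by lra. lra.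
    + rewrite Hz, nonneg_ext_eq in H by lra. specialize (Hn 0). lra.
Qed.

End SignPattern.

(** * The constant [K] and the threshold length *)

(** Finiteness uses [f 0 <= 0], whence [f p <= f p - f 0 <= C p]; positivity comes from any point of
    [(a, pM)]. *)
Lemma sup_ratio_bounds (f : R -> R) (a pM : R) :
  lipschitz_on_nonneg f -> sign_pattern f a pM ->
  exists K : R, sup_ratio f = Finite K /\ 0 < K /\
    forall p : R, 0 < p -> f p <= K * p.
Proof.
  intros [C HC] (Ha & _ & Hpos & _ & H0).
  destruct (Lub_Rbar_correct (fun k => exists p : R, 0 < p /\ k = f p / p))
    as [Hub Hleast].
  fold (sup_ratio f) in Hub, Hleast.
  assert (HCK : Rbar_le (sup_ratio f) C).
  { apply Hleast. intros k [p [Hp ->]]. simpl.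
    specialize (HC p 0). rewrite Rminus_0_r, (Rabs_pos_eq p) in HC by lra.
    pose proof (Rle_abs (f p - f 0)).
    apply Rcomplements.Rle_div_l; lra. }
  set (q := (a + pM) / 2).
  assert (Hq : a < q < pM) by (unfold q; lra).
  assert (Hfq : 0 < f q / q) by (apply Rdiv_lt_0_compat; [auto|lra]).
  assert (Hqle : Rbar_le (f q / q) (sup_ratio f)).
  { apply Hub. exists q. split; [lra|trivial]. }
  destruct (sup_ratio f) as [K| |]; [|contradiction|contradiction].
  simpl in Hqle. exists K. split; [trivial|split; [lra|]].
  intros p Hp. apply Rcomplements.Rle_div_l; trivial.
  apply (Hub (f p / p)). now exists p.
Qed.

(** The infimum is produced as the supremum of the lower bounds. *)
Lemma lower_bounded_inf (S : R -> Prop) (b L : R) :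
  S L -> (forall x : R, S x -> b <= x) ->
  exists m : R, b <= m /\ (forall x : R, S x -> m <= x) /\
    forall y : R, m < y -> exists x : R, S x /\ x < y.
Proof.
  intros HL Hb.
  destruct (completeness (fun z => forall x, S x -> z <= x)) as [m [Hm1 Hm2]].
  - exists L. intros z Hz. auto.
  - now exists b.
  - exists m. split; [|split].
    + now apply Hm1.
    + intros x Hx. apply Hm2. intros z Hz. auto.
    + intros y Hy. apply NNPP. intros Hno.
      assert (y <= m); [|lra].
      apply Hm1. intros x Hx. apply Rnot_lt_le. intros Hlt.
      apply Hno. now exists x.
Qed.

Theorem proposition1p4 (f : R -> R) (pM : R)
  (hpM : 0 < pM)
  (hlip : lipschitz_on_nonneg f)
  (hf : bistable f pM \/ monostable f pM) :
  Rbar_lt (sup_ratio f) p_infty /\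
  (RInt f 0 pM < 0 ->
     forall L : R, 0 < L -> ~ exists u : R -> R, is_solution f L u) /\
  (0 < RInt f 0 pM ->
     exists L0 : R,
       PI / sqrt (real (sup_ratio f)) <= L0 /\
       (forall L : R, 0 < L -> L < L0 ->
          ~ exists u : R -> R, is_solution f L u /\ nontrivial L u) /\
       (forall L : R, 0 < L -> L0 < L ->
          exists u : R -> R,
            is_solution f L u /\ nontrivial L u /\
            positivity_set_is_interior L u)).
Proof.
  destruct (sign_pattern_exists f pM hpM hf) as [a Hf].
  destruct (nonneg_ext_lipschitz f hlip) as [C Hg].
  destruct (sup_ratio_bounds f a pM hlip Hf) as [K [HK [HK0 HfK]]].
  rewrite HK, potential_nonneg_ext by lra. simpl real.
  split; [exact I|split].
  - intros HF L HL [u Hu]. revert Hu.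
    now apply no_solution_negative_mass with C a pM.
  - intros HF.
    destruct (reaching_length_exists f C a pM Hg Hf HF) as [L1 [HL1 HR1]].
    (* Every length in the set carries a positive solution, so [PI / sqrt K] is a lower bound and
       passes to the infimum. *)
    destruct (lower_bounded_inf
      (fun L => 0 < L /\ reaching_length f pM L) (PI / sqrt K) L1)
      as [L0 [Hb [Hlow Happ]]].
    + now split.
    + intros L [HL HR].
      destruct (reaching_length_solution f C a pM Hg Hf L HL HR)
        as [u [Hu1 Hu2]].
      now apply positive_solution_length with f u.
    + exists L0. split; [trivial|split].
      * intros L HL HLL0 [u [Hu1 Hu2]].
        (* A solution on [(0, L)] only makes strictly larger lengths reaching; the midpoint is one
           that still lies below [L0]. *)
        assert (L0 <= (L + L0) / 2); [|lra].
        apply Hlow. split; [lra|].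
        apply (solution_reaching_length f C a pM Hg Hf L _ u); trivial. lra.
      * intros L HL HLL0.
        destruct (Happ L HLL0) as [L2 [[HL2 HR2] HLL2]].
        destruct (reaching_length_solution f C a pM Hg Hf L HL)
          as [u [Hu1 Hu2]].
        { apply reaching_length_mono with L2; trivial. lra. }
        exists u. split; [trivial|split; [|trivial]].
        exists (L / 2). split; [lra|].
        apply Rgt_not_eq. apply Hu2; lra.
Qed.
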